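(* Let $P$ be a finite poset and let $p,q\in P$ be distinct elements, named so that $p<q$ if they are comparable. In the interval-closed set toggle group $T(\mathcal{IC}(P))$, $(t_pt_q)^2=1$ if and only if $p$ and $q$ are incomparable in $P$ or (in the case $p<q$) $q$ covers $p$ where $q$ is maximal and $p$ is minimal in $P$.
   Context: An interval-closed set in a poset $P$ is a subset $I\subseteq P$ such that if $x,y\in I$ and $x\le y$, then every $z\in P$ with $x\le z\le y$ is in $I$; $\mathcal{IC}(P)\subseteq 2^P$ is the set of interval-closed sets of $P$. For $p\in P$ the toggle $t_p:\mathcal{IC}(P)\to\mathcal{IC}(P)$ is given by $t_p(X)=X\cup\{p\}$ if $p\notin X$ and $X\cup\{p\}\in\mathcal{IC}(P)$; $t_p(X)=X\setminus\{p\}$ if $p\in X$ and $X\setminus\{p\}\in\mathcal{IC}(P)$; and $t_p(X)=X$ otherwise. $T(\mathcal{IC}(P))$ is the subgroup of the symmetric group on $\mathcal{IC}(P)$ generated by all $t_p$, $p\in P$. *)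

(* Defs.v *)
From HB Require Import structures.
From mathcomp Require Import all_boot all_order all_fingroup.

Set Implicit Arguments.
Unset Strict Implicit.
Unset Printing Implicit Defensive.

Import Order.TTheory.
Import GroupScope.
Local Open Scope order_scope.

Section PosetNotions.

Context {d : Order.disp_t} {P : finPOrderType d}.

Definition covers (q p : P) : Prop :=
  p < q /\ ~ (exists r : P, p < r /\ r < q).

Definition maximal (q : P) : Prop := forall r : P, ~ q < r.

Definition minimal (p : P) : Prop := forall r : P, ~ r < p.

Definition interval_closed (I : {set P}) : bool :=
  [forall x in I, forall y in I, (x <= y) ==>
     [forall z, (x <= z <= y) ==> (z \in I)]].

End PosetNotions.

Section Toggles.

Context {d : Order.disp_t} (P : finPOrderType d).

Record ICset := MkICset { ic_val :> {set P}; _ : interval_closed ic_val }.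

HB.instance Definition _ := [isSub for ic_val].
HB.instance Definition _ := [Finite of ICset by <:].

Definition toggle_set (p : P) (X : {set P}) : {set P} :=
  if (p \notin X) && interval_closed (p |: X) then p |: X
  else if (p \in X) && interval_closed (X :\ p) then X :\ p
  else X.

Lemma toggle_set_closed (p : P) (X : ICset) :
  interval_closed (toggle_set p X).
Proof.
rewrite /toggle_set; case: ifP => [/andP[] //|_].
by case: ifP => [/andP[] //|_]; case: X.
Qed.

Definition toggle_fun (p : P) (X : ICset) : ICset :=
  MkICset (toggle_set_closed p X).

Lemma toggle_funK (p : P) : involutive (toggle_fun p).
Proof.
case=> X icX; apply/val_inj; rewrite /= /toggle_set.
have [pX|pX] := boolP (p \in X) => /=.
  have [icXp|icXp] := boolP (interval_closed (X :\ p)).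
    by rewrite in_setD1 eqxx /= setD1K // icX.
  by rewrite pX (negPf icXp).
have [icXp|icXp] := boolP (interval_closed (p |: X)).
  by rewrite setU11 /= setU1K // icX.
by rewrite (negPf pX) (negPf icXp).
Qed.

Definition toggle (p : P) : {perm ICset} := perm (inv_inj (toggle_funK p)).

Definition toggle_group : {group {perm ICset}} :=
  <<[set toggle p | p : P]>>%G.

Lemma mem_toggle_group (p : P) : toggle p \in toggle_group.
Proof. by apply/mem_gen/imset_f. Qed.

(* The toggle t_p as an element of the group type [subg T(IC(P))]. The group
   law of {perm _} composes from left to right: s * t applies s first. Since
   toggles are involutions, (t_p * t_q)^-1 = t_q * t_p, so the order of
   composition does not affect whether (t_p * t_q) ^+ 2 = 1. *)
Definition toggle_elt (p : P) : [subg toggle_group] := Subg (mem_toggle_group p).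

End Toggles.

Arguments toggle {d P} p.
Arguments toggle_elt {d P} p.

(* Main.v *)
(** Toggling [p] and [q] moves a set around a square [Y], [Y + p], [Y + q],
    [Y + p + q] (symmetric differences), and [t_p], [t_q] commute on it unless
    exactly three of the four vertices are interval-closed.  A failure of
    interval-closedness of [Y] is a chain [x < z < y] with [x, y] in [Y] and [z]
    outside; it persists in [Y + p] if the chain avoids [p], and in [Y + q] if it
    avoids [q].  So the toggles commute when no three-element chain contains
    both [p] and [q].  Conversely, let [p < q].  If [r] lies strictly between them,
    then [{p, q}] is the only bad vertex of its square.  If nothing does, but
    [q < r] (resp. [r < p]), the only bad vertex is the closed interval from [p]
    to [r] without [q] (resp. from [r] to [q] without [p]). *)
Require Import Defs.
From mathcomp Require Import all_boot all_order all_fingroup.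

Set Implicit Arguments.
Unset Strict Implicit.
Unset Printing Implicit Defensive.

Import Order.TTheory.

Section FlipSquares.

Context {d : Order.disp_t} {P : finPOrderType d}.
Implicit Types (p q x y z : P) (X Y : {set P}) (I : ICset P).

Lemma interval_closedP X :
  reflect (forall x y z, x \in X -> y \in X -> (x <= z)%O -> (z <= y)%O -> z \in X)
          (interval_closed X).
Proof.
apply: (iffP idP) => [icX x y z xX yX xz zy | icX].
  move/forall_inP/(_ x xX)/forall_inP/(_ y yX): icX.
  by rewrite (le_trans xz zy) => /forallP/(_ z); rewrite xz zy.
apply/forall_inP=> x xX; apply/forall_inP=> y yX; apply/implyP=> _.
by apply/forallP=> z; apply/implyP=> /andP[]; apply: icX.
Qed.

(** Symmetric difference with [{p}], the unconditional form of the toggle. Flips are commuting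
    involutions, so only the closedness of the vertices matters. *)
Definition flip p X : {set P} := [set z | (z \in X) (+) (z == p)].

Lemma flipK p : involutive (flip p).
Proof. by move=> X; apply/setP=> z; rewrite !inE -addbA addbb addbF. Qed.

Lemma flipC p q X : flip p (flip q X) = flip q (flip p X).
Proof. by apply/setP=> z; rewrite !inE addbAC. Qed.

Lemma flip_id p z X : z != p -> (z \in flip p X) = (z \in X).
Proof. by rewrite inE => /negPf->; rewrite addbF. Qed.

Lemma mem_flip p X : (p \in flip p X) = (p \notin X).
Proof. by rewrite inE eqxx addbT. Qed.

Lemma toggle_set_flip p X :
  toggle_set p X = if interval_closed (flip p X) then flip p X else X.
Proof.
rewrite /toggle_set; have [pX|pX] /= := boolP (p \in X).
  suff -> : X :\ p = flip p X by [].
  by apply/setP=> z; rewrite !inE; case: eqP => [->|_]; rewrite ?pX ?addbF.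
suff -> : p |: X = flip p X by case: ifP.
by apply/setP=> z; rewrite !inE; case: eqP => [->|_]; rewrite ?(negPf pX) ?addbF.
Qed.

(** Toggles are involutions, so the square of their product is trivial exactly when they commute. *)
Lemma toggle_elt_sqrP p q :
  ((toggle_elt p * toggle_elt q) ^+ 2 = 1)%g <->
  (forall I, toggle_set p (toggle_set q I) = toggle_set q (toggle_set p I)).
Proof.
have inv r : ((toggle r)^-1 = toggle r :> {perm ICset P})%g.
  apply/permP=> I; apply: (@perm_inj _ (toggle r)).
  by rewrite permKV !permE toggle_funK.
have sqr1 : (toggle p * toggle q == toggle q * toggle p :> {perm ICset P})%g =
    ((toggle p * toggle q) ^+ 2 == 1 :> {perm ICset P})%g.
  by rewrite expgS expg1 -eq_invg_mul invMg !inv eq_sym.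
split=> [/(congr1 sgval) /eqP | C].
  (* The power in the subgroup type is convertible to the power of permutations. *)
  rewrite -[eqbLHS]/((toggle p * toggle q) ^+ 2)%g -sqr1 => /eqP/permP E I.
  by have := congr1 val (E I); rewrite !permM !permE.
apply/val_inj/eqP; rewrite -[eqbLHS]/((toggle p * toggle q) ^+ 2)%g -sqr1.
by apply/eqP/permP=> I; apply/val_inj; rewrite !permM !permE /= C.
Qed.

(** Start opposite [Y]. If [Y] alone were bad, the first toggle would succeed and the second would
    be blocked, so the two orders would end at distinct vertices, [flip p Y] and [flip q Y]. *)
Lemma toggle_setC_square p q Y :
  p != q ->
  (forall I, toggle_set p (toggle_set q I) = toggle_set q (toggle_set p I)) ->
  interval_closed (flip p Y) -> interval_closed (flip q Y) ->
  interval_closed (flip p (flip q Y)) -> interval_closed Y.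
Proof.
move=> neq_pq C icp icq icpq; apply/idPn=> nicY.
have /= := C (MkICset icpq); rewrite !toggle_set_flip flipK icq.
rewrite flipC !flipK icp flipK (negPf nicY).
by move/setP/(_ p); rewrite mem_flip flip_id //; case: (p \in Y).
Qed.

(** If the vertex opposite [I] is closed, the hypothesis makes both neighbours closed and both
    orders reach it. If it is bad, at most one neighbour is closed, and both orders end there or
    stay at [I]. *)
Lemma square_toggle_setC p q :
  (forall Y, interval_closed (flip p Y) -> interval_closed (flip q Y) ->
     interval_closed Y) ->
  forall I, toggle_set p (toggle_set q I) = toggle_set q (toggle_set p I).
Proof.
move=> sq [X icX] /=; rewrite !toggle_set_flip.
have := sq (flip p X); have := sq (flip q X); have := sq (flip p (flip q X)).
rewrite flipK !(flipC q p) !flipK icX.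
case: (boolP (interval_closed (flip p X))) => icp;
  case: (boolP (interval_closed (flip q X))) => icq;
  rewrite ?(flipC q p) ?flipK ?(negPf icp) ?(negPf icq) ?icp ?icq;
  case: (interval_closed (flip p (flip q X))) => // s1 s2 s3.
all: by [have := s1 isT isT | have := s2 isT isT | have := s3 isT isT].
Qed.

Lemma chain_free_square p q :
  (forall x y z, (x < z)%O -> (z < y)%O ->
     ~ (p \in [:: x; y; z] /\ q \in [:: x; y; z])) ->
  forall Y, interval_closed (flip p Y) -> interval_closed (flip q Y) ->
    interval_closed Y.
Proof.
move=> free Y icp icq; apply/interval_closedP=> x y z xY yY xz zy.
apply/idPn=> nzY.
have neq u : u \in Y -> u != z by apply: contraTneq => ->.
have avoid r : interval_closed (flip r Y) -> r \in [:: x; y; z].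
  move/interval_closedP=> icr; apply/idPn; rewrite !inE !negb_or.
  rewrite ![r == _]eq_sym => /and3P[xr yr zr]; case/negP: nzY.
  by rewrite -(flip_id Y zr); apply: (icr x y); rewrite ?flip_id.
by apply: (free x y z); rewrite ?lt_neqAle ?neq ?(eq_sym z) ?neq //; split; apply: avoid.
Qed.

Lemma square_covers p q :
  (p < q)%O ->
  (forall Y, interval_closed (flip p Y) -> interval_closed (flip q Y) ->
     interval_closed (flip p (flip q Y)) -> interval_closed Y) ->
  covers q p.
Proof.
move=> lt_pq sq; split=> // -[r [pr rq]].
have neq_pq : p != q by rewrite (lt_eqF lt_pq).
have ic1 (u : P) : interval_closed [set u].
  apply/interval_closedP=> x y z /set1P-> /set1P-> uz zu.
  by rewrite inE eq_le zu.
(* The other vertices of this square are [{q}], [{p}] and the empty set. *)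
have ic_pq : interval_closed [set p; q].
  have flip_q : flip q [set p; q] = [set p].
    apply/setP=> z; rewrite !inE; case: (z =P q) => [->|_].
      by rewrite orbT eq_sym (negPf neq_pq).
    by rewrite orbF addbF.
  apply: sq; rewrite ?flip_q //; last first.
    by apply/interval_closedP=> x; rewrite !inE addbb.
  suff -> : flip p [set p; q] = [set q] by [].
  apply/setP=> z; rewrite !inE; case: (z =P p) => [->|_].
    by rewrite (negPf neq_pq).
  by rewrite addbF.
move/interval_closedP/(_ p q r): ic_pq.
rewrite !inE !eqxx orbT (ltW pr) (ltW rq) (gt_eqF pr) (lt_eqF rq).
by move/(_ isT isT isT isT).
Qed.

Lemma square_maximal p q :
  covers q p ->
  (forall Y, interval_closed (flip p Y) -> interval_closed (flip q Y) ->
     interval_closed (flip p (flip q Y)) -> interval_closed Y) ->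
  maximal q.
Proof.
move=> [lt_pq ncov] sq r ltr.
have neq_pq : p != q by rewrite (lt_eqF lt_pq).
pose Y := flip q [set z | p <= z <= r]%O.
have pr := lt_trans lt_pq ltr.
suff /interval_closedP/(_ p r q) : interval_closed Y.
  rewrite !inE lexx (ltW pr) (ltW lt_pq) (ltW ltr) lexx eqxx (negPf neq_pq).
  by rewrite (gt_eqF ltr) => /(_ isT isT isT isT).
have flip_p : flip p [set z | p <= z <= r]%O = [set z | p < z <= r]%O.
  apply/setP=> z; rewrite !inE lt_neqAle [p == z]eq_sym; case: (z =P p) => [->|_].
    by rewrite lexx (ltW pr).
  by rewrite addbF.
apply: sq; rewrite ?flipK ?(flipC p q) ?flipK ?flip_p.
(* This vertex lacks both [p] and [q], and only here is covering needed: a member [x] below [q]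
   would lie strictly between [p] and [q]. *)
- apply/interval_closedP=> x y z; rewrite !inE.
  case: (x =P q) => [->|/eqP nxq]; first by rewrite lt_pq (ltW ltr).
  rewrite addbF => /andP[px _] yY xz zy.
  have zr : (z <= r)%O.
    by move: yY; case: (y =P q) zy => [-> zq _|_ zy];
      [exact: le_trans (ltW ltr) | rewrite addbF => /andP[_]; apply: le_trans].
  rewrite (lt_le_trans px xz) zr; apply/eqP => zq; apply: ncov; exists x.
  by rewrite px lt_neqAle nxq -zq.
- apply/interval_closedP=> x y z; rewrite !inE.
  move=> /andP[px _] /andP[_ yr] xz zy.
  by rewrite (le_trans px xz) (le_trans zy yr).
- apply/interval_closedP=> x y z; rewrite !inE.
  move=> /andP[px _] /andP[_ yr] xz zy.
  by rewrite (lt_le_trans px xz) (le_trans zy yr).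
Qed.

Lemma square_minimal p q :
  covers q p ->
  (forall Y, interval_closed (flip p Y) -> interval_closed (flip q Y) ->
     interval_closed (flip p (flip q Y)) -> interval_closed Y) ->
  minimal p.
Proof.
move=> [lt_pq ncov] sq r ltr.
have neq_pq : p != q by rewrite (lt_eqF lt_pq).
(* Order dual of the set used for maximality. *)
pose Y := flip p [set z | r <= z <= q]%O.
have rq := lt_trans ltr lt_pq.
suff /interval_closedP/(_ r q p) : interval_closed Y.
  rewrite !inE lexx (ltW rq) (ltW lt_pq) (ltW ltr) lexx eqxx [q == p]eq_sym.
  by rewrite (negPf neq_pq) (lt_eqF ltr) => /(_ isT isT isT isT).
have flip_q : flip q [set z | r <= z <= q]%O = [set z | r <= z < q]%O.
  apply/setP=> z; rewrite !inE lt_neqAle; case: (z =P q) => [->|_].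
    by rewrite lexx (ltW rq).
  by rewrite addbF.
apply: sq; rewrite ?flipK ?(flipC q p) ?flipK ?flip_q.
- apply/interval_closedP=> x y z; rewrite !inE.
  move=> /andP[rx _] /andP[_ yq] xz zy.
  by rewrite (le_trans rx xz) (le_trans zy yq).
(* Covering enters here: a member [y] above [p] would lie strictly between [p] and [q]. *)
- apply/interval_closedP=> x y z; rewrite !inE => xY.
  case: (y =P p) => [->|/eqP nyp]; first by rewrite lt_pq (ltW ltr).
  rewrite addbF => /andP[_ yq] xz zy.
  have rz : (r <= z)%O.
    by move: xY; case: (x =P p) xz => [-> pz _|_ xz];
      [exact: le_trans (ltW ltr) pz | rewrite addbF => /andP[rx _]; apply: le_trans xz].
  rewrite (le_lt_trans zy yq) rz; apply/eqP => zp; apply: ncov; exists y.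
  by rewrite yq lt_neqAle eq_sym nyp -zp.
- apply/interval_closedP=> x y z; rewrite !inE.
  move=> /andP[rx _] /andP[_ yq] xz zy.
  by rewrite (le_trans rx xz) (le_lt_trans zy yq).
Qed.

End FlipSquares.

Theorem lemma3p17 (d : Order.disp_t) (P : finPOrderType d) (p q : P)
    (hneq : p <> q) (hname : (p >=< q)%O -> (p < q)%O) :
  ((toggle_elt p * toggle_elt q) ^+ 2 = 1)%g <->
  ((p >< q)%O \/ (covers q p /\ maximal q /\ minimal p)).
Proof.
have neq_pq : p != q by apply/eqP.
apply: (iff_trans (toggle_elt_sqrP p q)); split=> [C | H].
  have [/hname lt_pq | ] := boolP (p >=< q)%O; [right | by left].
  have sq Y := @toggle_setC_square _ _ p q Y neq_pq C.
  have cov := square_covers lt_pq sq.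
  by split=> //; split; [apply: square_maximal cov sq | apply: square_minimal cov sq].
apply/square_toggle_setC/chain_free_square => x y z xz zy.
rewrite !inE => -[px qx].
have xy := lt_trans xz zy.
case: H => [nc | [[lt_pq ncov] [mx mn]]].
  case/negP: nc; move: px qx.
  by do 2![case/or3P=> /eqP->];
    rewrite /Order.comparable ?lexx // ?(ltW xz) ?(ltW zy) ?(ltW xy) ?orbT.
(* In the chain [x < z < y] only [x] can be minimal and only [y] maximal, so [z] contradicts
   covering. *)
have {}px : p = x.
  by case/or3P: px => /eqP // Ep; case: (mn x); rewrite Ep.
have {}qx : q = y.
  by case/or3P: qx => /eqP // Eq; case: (mx y); rewrite Eq.
by apply: ncov; exists z; rewrite px qx.
Qed.
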